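(* Let $L,M$ be two ordered binary mediators with potential outcomes $L(b)\in\{0,1\}$ and $M(b,l)\in\{0,1\}$ ($b,l\in\{0,1\}$), let $Y(b,l,m)$ be controlled potential outcomes, and let $S_L,S_{M,0},S_{M,1}\in\{0,1\}$ be baseline variables. Fix treatment levels $a,a'\in\{0,1\}$. Suppose necessity: for each $b\in\{0,1\}$, all $x$ and all $l\in\{0,1\}$, $P(L(b)=1\mid S_L=0,X=x)=0$ and $P(M(b,l)=1\mid S_{M,l}=0,X=x)=0$; and sufficiency-under-reference-treatment: for all $x$ and all $l\in\{0,1\}$, $P(L(a)=1\mid S_L=1,X=x)=1$ and $P(M(a',l)=1\mid S_{M,l}=1,X=x)=1$. Then $$\mathbb{E}[Y(a,L(a),M(a',L(a)))]=\sum_{l=0}^1\sum_{m=0}^1\mathbb{E}[Y(a,l,m)\mid S_L=l,S_{M,l}=m]\,P(S_L=l,S_{M,l}=m).$$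
   Context: All variables, including baseline covariates $X$, are defined on one probability space. $Y(a,L(a),M(a',L(a)))$ denotes $Y(a,l,m)$ evaluated at the random values $l=L(a)$ and $m=M(a',L(a))$. Conditional statements hold almost surely wherever the conditioning event has positive conditional probability; a summand with $P(S_L=l,S_{M,l}=m)=0$ is read as $0$. All displayed expectations are assumed finite. *)

(* Defs.v *)
From HB Require Import structures.
From mathcomp Require Import all_boot all_order all_algebra.
From mathcomp Require Import all_classical all_reals all_analysis.

Set Implicit Arguments.
Unset Strict Implicit.
Unset Printing Implicit Defensive.

Import Order.TTheory GRing.Theory Num.Theory.
Import numFieldNormedType.Exports.

Local Open Scope classical_set_scope.
Local Open Scope ring_scope.

(* g is a version of x |-> P(A | X = x):
   P(A, X \in C) = \int_C g(x) P_X(dx) for every measurable C. *)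
Definition is_cond_prob d d' (T : measurableType d) (T' : measurableType d')
    (R : realType) (P : probability T R) (X : {RV P >-> T'}) (A : set T)
    (g : T' -> R) : Prop :=
  (distribution P X).-integrable [set: T'] (EFin \o g) /\
  forall C : set T', measurable C ->
    (\int[distribution P X]_(x in C) (g x)%:E = P (A `&` X @^-1` C))%E.

(* P(A | X = x), a chosen version; see is_cond_prob_cond_prob for existence and
   is_cond_prob_unique for independence of the choice, up to P_X-null sets.
   The default value 0 is irrelevant when A is measurable. *)
Definition cond_prob d d' (T : measurableType d) (T' : measurableType d')
    (R : realType) (P : probability T R) (X : {RV P >-> T'}) (A : set T) :
    T' -> R :=
  xget (fun=> 0) [set g | is_cond_prob X A g].

(* P(A | B, X = x); meaningful where P(B | X = x) > 0. *)
Definition cond_prob_given d d' (T : measurableType d) (T' : measurableType d')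
    (R : realType) (P : probability T R) (X : {RV P >-> T'}) (A B : set T)
    (x : T') : R :=
  cond_prob X (A `&` B) x / cond_prob X B x.

(* E[Z | B] for an event B; meaningful when P(B) > 0. *)
Definition cond_expectation d (T : measurableType d) (R : realType)
    (P : probability T R) (Z : T -> R) (B : set T) : \bar R :=
  ((\int[P]_(w in B) (Z w)%:E) * ((fine (P B))^-1)%:E)%E.

Section cond_prob_theory.
Context d d' (T : measurableType d) (T' : measurableType d') (R : realType).
Variables (P : probability T R) (X : {RV P >-> T'}) (A : set T).

Lemma is_cond_prob_cond_prob : measurable A -> is_cond_prob X A (cond_prob X A).
Proof.
move=> mA; rewrite /cond_prob; case: xgetP => [g -> //|noversion].
have PAoo : (P A < +oo)%E by rewrite ltey_eq fin_num_measure.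
have mX : measurable_fun [set: T] (X : {mfun T >-> T'}) by [].
pose nu_ : {charge set T' -> \bar R} :=
  pushforward (charge_of_finite_measure (mfrestr mA PAoo)) (X : {mfun T >-> T'}).
pose nu := nu_ mX.
have nuE C : nu C = P (A `&` X @^-1` C) by rewrite setIC.
have dom : nu `<< distribution P X.
  apply/null_content_dominatesP => C mC PC0; rewrite nuE; apply/eqP.
  have mXC : measurable (X @^-1` C) by exact: measurable_funPTI.
  rewrite eq_le measure_ge0 andbT -PC0; apply: le_measure => //.
  - by rewrite inE; exact: measurableI.
  - by rewrite inE.
pose f := Radon_Nikodym nu (distribution P X).
have fE x : (fine (f x))%:E = f x by rewrite fineK// Radon_Nikodym_fin_num.
case: (noversion (fine \o f)); split => [|C mC].
  rewrite (_ : EFin \o _ = f); first exact: Radon_Nikodym_integrable.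
  by apply/funext => x /=.
by under eq_integral do rewrite /= fE; rewrite -nuE -Radon_Nikodym_integral.
Qed.

Lemma is_cond_prob_unique (g h : T' -> R) :
  is_cond_prob X A g -> is_cond_prob X A h ->
  {ae distribution P X, forall x, g x = h x}.
Proof.
move=> [ig gE] [ih hE].
have gh : ae_eq (distribution P X) setT (EFin \o g) (EFin \o h).
  apply: integral_ae_eq => //; first exact: measurable_int ih.
  by move=> C _ mC; rewrite gE// hE.
by apply: filterS gh => x /(_ I) [].
Qed.

End cond_prob_theory.

(* Main.v *)
(* Integrating the conditional statements over the law of X turns necessity and
   sufficiency into L(a) = S_L and M(a', l) = S_{M,l} almost surely. Hence the
   integrand on the left equals Y(a, l, m) almost surely on
   {S_L = l, S_{M,l} = m}, and these four events partition the space. *)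

Require Import Defs.
From mathcomp Require Import all_boot all_order all_algebra.
From mathcomp Require Import all_classical all_reals all_analysis.
From mathcomp Require Import measurable_realfun.

Set Implicit Arguments.
Unset Strict Implicit.
Unset Printing Implicit Defensive.

Import Order.TTheory GRing.Theory Num.Theory.
Import numFieldNormedType.Exports.

Local Open Scope classical_set_scope.
Local Open Scope ring_scope.

Lemma measurable_bool_eq d (T : measurableType d) (S : {mfun T >-> bool})
    (b : bool) : measurable [set w | S w = b].
Proof. exact: (measurable_funPTI S (_ : measurable [set b])). Qed.

(** The domain [D] is arbitrary so that the split can be iterated: first along [SL], then along
    [SM l] inside the slice [SL = l]. *)
Lemma integral_split_bool d (T : measurableType d) (R : realType)
    (mu : {measure set T -> \bar R}) (S : {mfun T >-> bool}) (D : set T)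
    (f : T -> \bar R) :
  measurable D -> measurable_fun D f ->
  (\int[mu]_(w in D) f w =
   \sum_(b : bool) \int[mu]_(w in D `&` [set w | S w = b]) f w)%E.
Proof.
move=> mD mf.
have DE : D = (D `&` [set w | S w = true]) `|` (D `&` [set w | S w = false]).
  by apply/seteqP; split=> w /=; [case: (S w); [left|right] | case=> -[]].
rewrite big_bool /= {1}DE integral_setU //.
- exact/measurableI/measurable_bool_eq.
- exact/measurableI/measurable_bool_eq.
- by rewrite -DE.
- by rewrite disj_set2E; apply/eqP/seteqP; split=> w //= [[_ ->] []].
Qed.

Lemma probability_split_bool d (T : measurableType d) (R : realType)
    (P : probability T R) (S : {mfun T >-> bool}) (D : set T) :
  measurable D ->
  P D = (P ([set w | S w = true] `&` D) +
         P ([set w | S w = false] `&` D))%E.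
Proof.
move=> mD; rewrite -measureU.
- congr (P _); apply/seteqP; split=> w /=; last by case=> -[].
  by case: (S w); [left|right].
- exact: measurableI (measurable_bool_eq S true) mD.
- exact: measurableI (measurable_bool_eq S false) mD.
- by apply/seteqP; split=> w //= [[-> _] []].
Qed.

(* On [C = {x | P(B | X = x) <= 0}] the hypothesis is void, but [B] itself has
   probability 0 there. *)
Lemma cond_prob_given_cst d d' (T : measurableType d) (T' : measurableType d')
    (R : realType) (P : probability T R) (X : {RV P >-> T'}) (A B : set T)
    (k : R) :
  measurable A -> measurable B ->
  {ae distribution P X, forall x,
     0 < cond_prob X B x -> cond_prob_given X A B x = k} ->
  P (A `&` B) = (k%:E * P B)%E.
Proof.
move=> mA mB ABk.
have mAB : measurable (A `&` B) by exact: measurableI.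
have [iB PB] := is_cond_prob_cond_prob X mB.
have [iAB PAB] := is_cond_prob_cond_prob X mAB.
set g := cond_prob X B in iB PB ABk *.
set h := cond_prob X (A `&` B) in iAB PAB *.
(* The version [g] is only known through its integrals and may take negative values, hence [<=]
   rather than equality; off [C] the hypothesis applies. *)
pose C : set T' := [set x | g x <= 0].
have mg : measurable_fun [set: T'] g by exact/measurable_EFinP/(measurable_int _ iB).
have mC : measurable C.
  rewrite /C (_ : [set x | _] = [set: T'] `&` g @^-1` `]-oo, 0]).
    by apply: mg => //; exact: measurable_itv.
  by apply/seteqP; split=> x; rewrite /= in_itv /=; tauto.
have mXC : measurable (X @^-1` C) by exact: measurable_funPTI.
have mCc := measurableC mC.
have mXCc : measurable (X @^-1` (~` C)) by exact: measurable_funPTI.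
(* This probability is the integral of [g] over [C], where [g] is nonpositive. *)
have BC0 : P (B `&` X @^-1` C) = 0%E.
  apply/eqP; rewrite eq_le measure_ge0 andbT -PB //.
  rewrite -(integral0 (distribution P X) C); apply: le_integral => //.
  - exact: integrableS iB.
  - exact: integrable0.
  - by move=> x; rewrite inE lee_fin.
have ABC0 : P ((A `&` B) `&` X @^-1` C) = 0%E.
  apply/eqP; rewrite eq_le measure_ge0 andbT -BC0.
  apply: le_measure; rewrite ?inE; [exact: measurableI..|].
  by move=> w [[]].
have PD (D : set T) : measurable D ->
    P (D `&` X @^-1` C) = 0%E -> P D = P (D `&` X @^-1` (~` C)).
  move=> mD DC0; rewrite -{1}(setIT D) -(setvU (X @^-1` C)) setIUr measureU.
  - by rewrite [X in (_ + X)%E]DC0 adde0.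
  - exact: measurableI.
  - exact: measurableI.
  - by rewrite setIACA setICl setI0.
(* Both sides become integrals over the complement of [C], of [h] and of [k * g]. There [g > 0], so
   [h / g = k] can be cleared of its denominator almost everywhere. *)
rewrite (PD _ mAB ABC0) (PD _ mB BC0) -PAB // -PB // -integralZl //; last first.
  exact: integrableS iB.
apply: ae_eq_integral => //.
- exact: measurable_funTS (measurable_int _ iAB).
- apply: measurable_funTS; apply: emeasurable_funM => //.
  exact: measurable_int iB.
apply: filterS ABk => x gk /= /negP; rewrite -ltNge => g0.
by rewrite -EFinM; congr EFin; exact: canRL (divfK (lt0r_neq0 g0)) (gk g0).
Qed.

(** [U] and [S] can differ in two ways only: necessity makes [U = true, S = false] a null event, and
    sufficiency does the same for [U = false, S = true]. *)
Lemma ae_eq_cond_prob_given d d' (T : measurableType d)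
    (T' : measurableType d') (R : realType) (P : probability T R)
    (X : {RV P >-> T'}) (U S : {RV P >-> bool}) :
  {ae distribution P X, forall x,
     0 < cond_prob X [set w | S w = false] x ->
     cond_prob_given X [set w | U w = true] [set w | S w = false] x = 0} ->
  {ae distribution P X, forall x,
     0 < cond_prob X [set w | S w = true] x ->
     cond_prob_given X [set w | U w = true] [set w | S w = true] x = 1} ->
  {ae P, forall w, U w = S w}.
Proof.
have mU := measurable_bool_eq U; have mS := measurable_bool_eq S.
move=> /(cond_prob_given_cst (mU _) (mS _)); rewrite mul0e => nec.
move=> /(cond_prob_given_cst (mU _) (mS _)); rewrite mul1e => suf.
have P0 : P ([set w | U w = false] `&` [set w | S w = true]) = 0%E.
  have finS : P [set w | S w = true] \is a fin_num by exact: fin_num_measure.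
  (* Add and subtract the finite mass of [S = true]; by [suf] the added copy is the mass of
     [U = S = true], which completes the split of [S = true] along [U]. *)
  rewrite -[LHS](addeK _ finS) [X in (X - _)%E]addeC -{1}suf.
  by rewrite -probability_split_bool ?subee.
exists (([set w | U w = true] `&` [set w | S w = false]) `|`
        ([set w | U w = false] `&` [set w | S w = true])); split.
- by apply: measurableU; exact: measurableI.
- by rewrite measureU0 //; exact: measurableI.
- by move=> w /=; case: (U w); case: (S w) => // _; [left|right].
Qed.

Theorem mainTheorem7
  (d d' : measure_display) (T : measurableType d) (TX : measurableType d')
  (R : realType) (P : probability T R)
  (X : {RV P >-> TX})
  (L : bool -> {RV P >-> bool})
  (M : bool -> bool -> {RV P >-> bool})
  (Y : bool -> bool -> bool -> {RV P >-> R})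
  (SL : {RV P >-> bool})
  (SM : bool -> {RV P >-> bool})
  (a a' : bool)
  (necessity_L : forall b : bool, {ae distribution P X, forall x,
     0 < cond_prob X [set w | SL w = false] x ->
     cond_prob_given X [set w | L b w = true] [set w | SL w = false] x = 0})
  (necessity_M : forall b l : bool, {ae distribution P X, forall x,
     0 < cond_prob X [set w | SM l w = false] x ->
     cond_prob_given X [set w | M b l w = true] [set w | SM l w = false] x = 0})
  (sufficiency_L : {ae distribution P X, forall x,
     0 < cond_prob X [set w | SL w = true] x ->
     cond_prob_given X [set w | L a w = true] [set w | SL w = true] x = 1})
  (sufficiency_M : forall l : bool, {ae distribution P X, forall x,
     0 < cond_prob X [set w | SM l w = true] x ->
     cond_prob_given X [set w | M a' l w = true] [set w | SM l w = true] x = 1})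
  (finite_lhs : P.-integrable [set: T]
     (fun w => (Y a (L a w) (M a' (L a w) w) w)%:E))
  (finite_rhs : forall l m : bool,
     P [set w | SL w = l /\ SM l w = m] != 0%E ->
     P.-integrable [set w | SL w = l /\ SM l w = m]
       (fun w => (Y a l m w)%:E)) :
  ('E_P[fun w => Y a (L a w) (M a' (L a w) w) w] =
   \sum_(l : bool) \sum_(m : bool)
     (if P [set w | SL w = l /\ SM l w = m] == 0 then 0
      else cond_expectation P (Y a l m) [set w | SL w = l /\ SM l w = m] *
           P [set w | SL w = l /\ SM l w = m]))%E.
Proof.
(* Necessity is taken at the level where sufficiency is assumed: [a] for [L], [a'] for [M]. *)
have LS := ae_eq_cond_prob_given (necessity_L a) sufficiency_L.
have MS l := ae_eq_cond_prob_given (necessity_M a' l) (sufficiency_M l).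
set f := fun w => Y a (L a w) (M a' (L a w) w) w.
have mf D : measurable_fun D (EFin \o f).
  exact: measurable_funTS (measurable_int _ finite_lhs).
rewrite unlock (integral_split_bool P SL) //.
apply: eq_bigr => l _.
rewrite setTI (integral_split_bool P (SM l)) //; last exact: measurable_bool_eq.
apply: eq_bigr => m _.
set E := [set w | SL w = l /\ SM l w = m].
have mE : measurable E by apply: measurableI; exact: measurable_bool_eq.
(* On a null cell the summand is 0 by convention, and so is the integral. *)
case: eqP => [E0|/eqP E0]; first exact: null_set_integral.
have fE0 : (fine (P E) != 0)%R by rewrite fine_eq0 ?fin_num_measure.
(* The weight [P E] cancels the normalisation of the conditional expectation, leaving the integral
   of [Y a l m] over [E]. *)
rewrite /cond_expectation -muleA -{2}(@fineK _ (P E)) ?fin_num_measure //.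
rewrite -EFinM mulVf // mule1.
apply: ae_eq_integral => //.
  exact: measurable_int (finite_rhs _ _ E0).
apply: filterS2 LS (MS l) => w Lw Mw [SLw SMw].
(* The order matters: [L a w] must first become [l], so that the nested mediator is [M a' l w], to
   which [Mw] applies. *)
by rewrite /f /= Lw SLw Mw SMw.
Qed.
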